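(* Let $\Lambda$ be a $k$-graph and suppose there is a map $b:\Lambda^0\to\mathbf{Z}^k$ such that $d(\lambda)=b(s(\lambda))-b(r(\lambda))$ for all $\lambda\in\Lambda$. Then $C^*(\Lambda)$ is AF.
   Context: Let $\mathbf{N}=\{0,1,2,\dots\}$, $k\ge 1$, and order $\mathbf{N}^k$ coordinatewise. A $k$-graph $(\Lambda,d)$ is a countable small category $\Lambda$ (range map $r$, source map $s$) with a functor $d:\Lambda\to\mathbf{N}^k$ satisfying the factorisation property: if $d(\lambda)=m+n$ there are unique $\mu,\nu\in\Lambda$ with $\lambda=\mu\nu$, $d(\mu)=m$, $d(\nu)=n$. $\lambda\mu$ is defined iff $s(\lambda)=r(\mu)$. Put $\Lambda^n=d^{-1}(n)$; $\Lambda^0$ is identified with the set of objects; $\Lambda^n(v)=\{\lambda\in\Lambda^n: r(\lambda)=v\}$. Standing assumption: $0<\#\Lambda^n(v)<\infty$ for all $v\in\Lambda^0$, $n\in\mathbf{N}^k$. $C^*(\Lambda)$ is the universal $C^*$-algebra generated by partial isometries $\{s_\lambda:\lambda\in\Lambda\}$ satisfying: (i) $\{s_v: v\in\Lambda^0\}$ are mutually orthogonal projections; (ii) $s_{\lambda\mu}=s_\lambda s_\mu$ whenever $s(\lambda)=r(\mu)$; (iii) $s_\lambda^*s_\lambda=s_{s(\lambda)}$; (iv) $s_v=\sum_{\lambda\in\Lambda^n(v)}s_\lambda s_\lambda^*$ for all $v\in\Lambda^0$, $n\in\mathbf{N}^k$. AF means approximately finite-dimensional (the closure of an increasing union of a sequence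 of finite-dimensional $C^*$-subalgebras). *)

(* Defs.v *)
(* The complex scalars are [R[i]] for [R : realType]. *)
From HB Require Import structures.
From mathcomp Require Import all_boot all_order all_algebra.
From mathcomp Require Import all_classical all_reals all_analysis.
From mathcomp Require Import complex.

Set Implicit Arguments.
Unset Strict Implicit.
Unset Printing Implicit Defensive.

Import Order.TTheory GRing.Theory Num.Theory.
Import numFieldNormedType.Exports.

Local Open Scope classical_set_scope.
Local Open Scope ring_scope.
Local Open Scope complex_scope.

(* A [k]-graph, as a category with a set of objects and a single set of
   morphisms.  [kcompose l m] stands for the composite [l m], which exists only when
   [ksrc l = krng m]: it is a total function whose values on other pairs are
   unconstrained.  Countability is carried by [countType].  The degree takes
   values in the additive monoid ['rV[nat]_k], that is N^k. *)
Record kgraph (k : nat) := KGraph {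
  kobj : countType;
  kmor :> countType;
  krng : kmor -> kobj;
  ksrc : kmor -> kobj;
  kid : kobj -> kmor;
  kcompose : kmor -> kmor -> kmor;
  kdeg : kmor -> 'rV[nat]_k;
  krng_id : forall v, krng (kid v) = v;
  ksrc_id : forall v, ksrc (kid v) = v;
  krng_comp : forall l m, ksrc l = krng m -> krng (kcompose l m) = krng l;
  ksrc_comp : forall l m, ksrc l = krng m -> ksrc (kcompose l m) = ksrc m;
  kcomp_idl : forall l, kcompose (kid (krng l)) l = l;
  kcomp_idr : forall l, kcompose l (kid (ksrc l)) = l;
  kcompA : forall l m n, ksrc l = krng m -> ksrc m = krng n ->
    kcompose l (kcompose m n) = kcompose (kcompose l m) n;
  kdeg_id : forall v, kdeg (kid v) = 0;
  kdeg_comp : forall l m, ksrc l = krng m ->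
    kdeg (kcompose l m) = kdeg l + kdeg m;
  kfactorisation : forall (l : kmor) (m n : 'rV[nat]_k), kdeg l = m + n ->
    exists! p : kmor * kmor,
      [/\ ksrc p.1 = krng p.2, l = kcompose p.1 p.2, kdeg p.1 = m & kdeg p.2 = n]
}.

(* The set of paths of degree [n] with range [v], written Lambda^n(v). *)
Definition paths_at (k : nat) (L : kgraph k) (n : 'rV[nat]_k) (v : kobj L)
  : set L := [set l | kdeg l = n /\ krng l = v].

Definition row_finite_no_sources (k : nat) (L : kgraph k) : Prop :=
  forall (v : kobj L) (n : 'rV[nat]_k),
    paths_at n v !=set0 /\ finite_set (paths_at n v).

(* C*-algebras need not have a unit, so the product is not that of a MathComp
   ring. *)
HB.mixin Record isCStarAlgebra (R : realType) A
    of CompleteNormedModule R[i] A := {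
  cmul : A -> A -> A;
  cstar : A -> A;
  cmulA : associative cmul;
  cmulDl : left_distributive cmul +%R;
  cmulDr : right_distributive cmul +%R;
  cscalerAl : forall (a : R[i]) (x y : A), a *: cmul x y = cmul (a *: x) y;
  cscalerAr : forall (a : R[i]) (x y : A), a *: cmul x y = cmul x (a *: y);
  cnormM : forall x y : A, `|cmul x y| <= `|x| * `|y|;
  cstarK : involutive cstar;
  cstarD : forall x y : A, cstar (x + y) = cstar x + cstar y;
  cstarZ : forall (a : R[i]) (x : A), cstar (a *: x) = a^*%C *: cstar x;
  cstarM : forall x y : A, cstar (cmul x y) = cmul (cstar y) (cstar x);
  cnorm_star : forall x : A, `|cmul (cstar x) x| = `|x| ^+ 2
}.

#[short(type="cstarAlgType")]
HB.structure Definition CStarAlgebra (R : realType) :=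
  {A of isCStarAlgebra R A & CompleteNormedModule R[i] A}.

Section CStarAlgebraNotions.
Variables (R : realType) (A : cstarAlgType R).
Implicit Types (B F : set A) (p x : A).

Definition is_projection p : Prop := cmul p p = p /\ cstar p = p.

Definition is_partial_isometry x : Prop := cmul (cmul x (cstar x)) x = x.

Definition is_cstar_subalgebra B : Prop :=
  [/\ [/\ B 0,
          forall x y, B x -> B y -> B (x + y) &
          forall (a : R[i]) x, B x -> B (a *: x)],
      forall x y, B x -> B y -> B (cmul x y),
      forall x, B x -> B (cstar x) &
      closed B].

Definition is_finite_dim F : Prop :=
  exists (m : nat) (e : 'I_m -> A),
    F = [set x | exists c : 'I_m -> R[i], x = \sum_(i < m) c i *: e i].

Definition generates (I : Type) (s : I -> A) : Prop :=
  forall B, is_cstar_subalgebra B -> (forall i, B (s i)) -> B = setT.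

Definition is_AF : Prop :=
  exists F : nat -> set A,
    [/\ forall n, is_cstar_subalgebra (F n),
        forall n, is_finite_dim (F n),
        forall n, F n `<=` F n.+1 &
        closure (\bigcup_n F n) = setT].

End CStarAlgebraNotions.

(* Continuity is not required: it is automatic for *-homomorphisms. *)
Definition is_star_hom (R : realType) (A B : cstarAlgType R) (f : A -> B)
  : Prop :=
  [/\ forall x y, f (x + y) = f x + f y,
      forall (a : R[i]) x, f (a *: x) = a *: f x,
      forall x y, f (cmul x y) = cmul (f x) (f y) &
      forall x, f (cstar x) = cstar (f x)].

(* The generators s_v attached to vertices are those of the identity
   morphisms. *)
Definition is_kgraph_family (R : realType) (k : nat) (L : kgraph k)
    (A : cstarAlgType R) (s : L -> A) : Prop :=
  [/\ forall l, is_partial_isometry (s l),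
      (forall v : kobj L, is_projection (s (kid v))) /\
      (forall v w : kobj L, v <> w -> cmul (s (kid v)) (s (kid w)) = 0),
      forall l m : L, ksrc l = krng m -> s (kcompose l m) = cmul (s l) (s m),
      forall l : L, cmul (cstar (s l)) (s l) = s (kid (ksrc l)) &
      forall (v : kobj L) (n : 'rV[nat]_k),
        s (kid v) = \sum_(l \in paths_at n v) cmul (s l) (cstar (s l))].

(* [A], with the generators [s], is C*(L).  The universal property determines
   the pair up to isomorphism; uniqueness of [f] follows from [generates]. *)
Definition is_kgraph_cstar (R : realType) (k : nat) (L : kgraph k)
    (A : cstarAlgType R) (s : L -> A) : Prop :=
  [/\ is_kgraph_family s,
      generates s &
      forall (B : cstarAlgType R) (t : L -> B), is_kgraph_family t ->
        exists f : A -> B, is_star_hom f /\ forall l, f (s l) = t l].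

(* Main.v *)
Require Import Defs.
From mathcomp Require Import all_boot all_order all_algebra.
From mathcomp Require Import all_classical all_reals all_analysis.
From mathcomp Require Import complex ring lra zify.

(** The hypothesis on the degree makes [b] a potential.  Fix a level [n] in Z^k.
    Two distinct paths [l], [m] whose sources have level [n] satisfy
    [s_l^* s_m = 0]: either they have different ranges, or they have the same range,
    hence the same degree, and then [s_l s_l^*] and [s_m s_m^*] are distinct summands
    of a decomposition of a vertex projection ([level_orth]).  So the elements
    [s_l s_m^*], for [l], [m] with a common source of level [n], multiply like matrix
    units, and any finite set of paths ending at level [n] yields a finite-dimensional
    *-algebra.  The relation [s_v = sum s_nu s_nu^*] rewrites [s_l s_m^*] as the sum
    of the [s_(l nu) s_(m nu)^*], which pushes units from one level to any higher one
    ([family_unit_expand]).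

    This gives an increasing sequence: at stage [N] one takes the paths that end at
    level [(N, ..., N)] and extend a path whose number in an enumeration of
    [L] is less than [N] ([frontier]).  There are finitely many of them, and extending them to level
    [(N+1, ..., N+1)] stays within stage [N+1] ([frontier_increasing]).  Every
    generator [s_l = s_l s_v^*], [v] the source of [l], lies in some stage
    ([frontier_generator]), and the closure of the union is a C*-subalgebra, so it is
    everything.

    Two facts of functional analysis are needed.  Finite-dimensional subspaces are
    closed ([closed_lin_span]), by adding one vector at a time.  And projections
    [q_i] that sum to a projection are mutually orthogonal.  Here this is proved from
    the C*-identity, without spectral theory: if [sum_i p q_i p = 0], then each
    [a = p q_i p] satisfies [|p - a| <= 1] and [|M p + a| <= M] for some real
    [M > 0], so that both [a] and [-a] are positive in the metric sense; this forces
    [a = 0] because [p] is the unit of the corner [p A p], and the unit of a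
    C*-algebra admits no nonzero self-adjoint [h] with [|p + h| <= 1] and
    [|p - h| <= 1] ([corner_vertex]). *)

Set Implicit Arguments.
Unset Strict Implicit.
Unset Printing Implicit Defensive.

Import Order.TTheory GRing.Theory Num.Theory.
Import numFieldNormedType.Exports.

Local Open Scope classical_set_scope.
Local Open Scope ring_scope.
Local Open Scope complex_scope.

Local Notation "x ** y" := (cmul x y) (at level 40, left associativity).
Local Notation "x ^#" := (cstar x) (at level 2, format "x ^#").

(** * The norm as a real number *)

Section RealNorm.
Context {R : realType} {V : normedModType R[i]}.
Implicit Types x y : V.

(** The norm takes its values in [R[i]], whose order is only partial; its real part
    carries the same information and lives in a totally ordered field. *)
Definition rnorm x : R := complex.Re `|x|.

Lemma rnormE x : `|x| = (rnorm x)%:C.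
Proof. by rewrite /rnorm RRe_real // ger0_real. Qed.

Lemma rnorm_ge0 x : 0 <= rnorm x.
Proof. by rewrite -ler0c -rnormE. Qed.

Lemma rnorm0 : rnorm (0 : V) = 0.
Proof. by rewrite /rnorm normr0. Qed.

Lemma rnormN x : rnorm (- x) = rnorm x.
Proof. by rewrite /rnorm normrN. Qed.

Lemma rnormD x y : rnorm (x + y) <= rnorm x + rnorm y.
Proof. by rewrite -lecR rmorphD /= -!rnormE ler_normD. Qed.

Lemma rnormBC x y : rnorm (x - y) = rnorm (y - x).
Proof. by rewrite -rnormN opprB. Qed.

Lemma rnormBD z x y : rnorm (x - y) <= rnorm (x - z) + rnorm (z - y).
Proof. by rewrite -[x](subrK z) -addrA addrK rnormD. Qed.

Lemma rnorm_eq0 x : rnorm x = 0 -> x = 0.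
Proof. by move=> x0; apply/normr0_eq0; rewrite rnormE x0. Qed.

Lemma rnormZ (a : R[i]) x : rnorm (a *: x) = complex.Re `|a| * rnorm x.
Proof.
apply: (@complexI R); rewrite -rnormE normrZ rnormE rmorphM /=.
by rewrite (RRe_real (ger0_real (normr_ge0 a))).
Qed.

Lemma rnormZR (t : R) x : rnorm (t%:C *: x) = `|t| * rnorm x.
Proof. by rewrite rnormZ normc_def /= expr0n /= addr0 sqrtr_sqr. Qed.

End RealNorm.

(** * Projections whose sum is a projection *)

Section CStarAlgebra.
Context {R : realType} {A : cstarAlgType R}.
Implicit Types (x y z u v h p q : A).

Lemma cmul0x x : 0 ** x = 0.
Proof. by apply: (addrI (0 ** x)); rewrite -cmulDl !addr0. Qed.

Lemma cmulx0 x : x ** 0 = 0.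
Proof. by apply: (addrI (x ** 0)); rewrite -cmulDr !addr0. Qed.

Lemma cmulNx x y : (- x) ** y = - (x ** y).
Proof. by apply/eqP; rewrite -addr_eq0 -cmulDl addNr cmul0x. Qed.

Lemma cmulxN x y : x ** (- y) = - (x ** y).
Proof. by apply/eqP; rewrite -addr_eq0 -cmulDr addNr cmulx0. Qed.

Lemma cmulBl x y z : (x - y) ** z = x ** z - y ** z.
Proof. by rewrite cmulDl cmulNx. Qed.

Lemma cmulBr x y z : x ** (y - z) = x ** y - x ** z.
Proof. by rewrite cmulDr cmulxN. Qed.

Lemma cmulZl (a : R[i]) x y : (a *: x) ** y = a *: (x ** y).
Proof. by rewrite cscalerAl. Qed.

Lemma cmulZr (a : R[i]) x y : x ** (a *: y) = a *: (x ** y).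
Proof. by rewrite cscalerAr. Qed.

Lemma cstar0 : (0 : A)^# = 0.
Proof. by apply: (addrI (0 : A)^#); rewrite -cstarD !addr0. Qed.

Lemma cstarN x : (- x)^# = - x^#.
Proof. by apply/eqP; rewrite -addr_eq0 -cstarD addNr cstar0. Qed.

Lemma cstarB x y : (x - y)^# = x^# - y^#.
Proof. by rewrite cstarD cstarN. Qed.

Lemma conjC_real (t : R) : (t%:C)^*%C = t%:C.
Proof. by rewrite /conjc /= oppr0. Qed.

Lemma cstarZR (t : R) x : (t%:C *: x)^# = t%:C *: x^#.
Proof. by rewrite cstarZ conjC_real. Qed.

Lemma cmul_suml (I : Type) (r : seq I) (f : I -> A) x :
  (\sum_(i <- r) f i) ** x = \sum_(i <- r) f i ** x.
Proof. by elim/big_rec2: _ => [|i y z _ <-]; rewrite ?cmul0x ?cmulDl. Qed.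

Lemma cmul_sumr (I : Type) (r : seq I) (f : I -> A) x :
  x ** (\sum_(i <- r) f i) = \sum_(i <- r) x ** f i.
Proof. by elim/big_rec2: _ => [|i y z _ <-]; rewrite ?cmulx0 ?cmulDr. Qed.

Lemma rnormM x y : rnorm (x ** y) <= rnorm x * rnorm y.
Proof. by rewrite -lecR rmorphM /= -!rnormE cnormM. Qed.

Lemma rnorm_starM x : rnorm (x^# ** x) = rnorm x ^+ 2.
Proof. by apply: (@complexI R); rewrite rmorphXn /= -!rnormE cnorm_star. Qed.

Lemma rnorm_star_le x : rnorm x <= rnorm x^#.
Proof.
have [->|x0] := eqVneq (rnorm x) 0; first exact: rnorm_ge0.
have xp : 0 < rnorm x by rewrite lt_def x0 rnorm_ge0.
by rewrite -(ler_pM2r xp) -expr2 -rnorm_starM rnormM.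
Qed.

Lemma rnorm_star x : rnorm x^# = rnorm x.
Proof.
by apply/eqP; rewrite eq_le rnorm_star_le andbT -{2}[x]cstarK rnorm_star_le.
Qed.

Lemma rnorm_eq0_starM x : x^# ** x = 0 -> x = 0.
Proof.
move=> x0; apply: rnorm_eq0; apply/eqP.
by rewrite -(sqrf_eq0 (rnorm x)) -rnorm_starM x0 rnorm0.
Qed.

(** A substitute for the monotonicity of the norm on positive elements: the
    hypothesis says that [x - z] is orthogonal to [z], as for a projection
    [z = q x]. *)
Lemma rnorm_le_starM z x : z^# ** x = z^# ** z -> rnorm z <= rnorm x.
Proof.
move=> zx; have [->|z0] := eqVneq (rnorm z) 0; first exact: rnorm_ge0.
have zp : 0 < rnorm z by rewrite lt_def z0 rnorm_ge0.
by rewrite -(ler_pM2l zp) -expr2 -rnorm_starM -zx -(rnorm_star z) rnormM.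
Qed.

Lemma proj_rnorm_le1 p : is_projection p -> rnorm p <= 1.
Proof.
case=> pp sp; have := rnorm_starM p; rewrite sp pp expr2 => e.
have := rnorm_ge0 p; nra.
Qed.

Lemma proj_compl_rnorm q x : is_projection q -> rnorm (x - q ** x) <= rnorm x.
Proof.
case=> qq sq; apply: rnorm_le_starM.
rewrite cstarB cstarM sq !(cmulBl, cmulBr) !cmulA -[_ ** q ** q]cmulA qq.
by rewrite subrr subr0.
Qed.

(** [p - p q p] is [y^* y] with [y = (1 - q) p], and [y] is a contraction. *)
Lemma proj_compress_rnorm p q : is_projection p -> is_projection q ->
  rnorm (p - p ** q ** p) <= 1.
Proof.
move=> pP qP; have [[pp sp] [qq sq]] := (pP, qP).
have -> : p - p ** q ** p = (p - q ** p)^# ** (p - q ** p).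
  rewrite cstarB cstarM sp sq !(cmulBl, cmulBr) !cmulA pp.
  by rewrite -[p ** q ** q]cmulA qq subrr subr0.
have := proj_compl_rnorm p qP; have := proj_rnorm_le1 pP.
have := rnorm_ge0 (p - q ** p).
rewrite rnorm_starM expr2; nra.
Qed.

(** With [z = u + i v] one has [z^* z = u^2 + v^2] and [2 u = z + z^*]. *)
Lemma rnorm_two_squares u v : u^# = u -> v^# = v -> u ** v = v ** u ->
  rnorm u ^+ 2 <= rnorm (u ** u + v ** v).
Proof.
move=> su sv uv; pose z := u + 'i%C *: v.
have sz : z^# = u - 'i%C *: v.
  rewrite cstarD cstarZ su sv.
  have -> : ('i%C)^*%C = - 'i%C :> R[i].
    by apply/eqP; rewrite eq_complex /= oppr0 !eqxx.
  by rewrite scaleNr.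
have zz : z^# ** z = u ** u + v ** v.
  rewrite sz /z !(cmulBl, cmulDr, cmulZl, cmulZr) uv.
  rewrite scalerA -expr2 sqr_i scaleN1r ?opprK.
  by rewrite opprD opprK addrA addrK.
have u2 : rnorm u <= rnorm z.
  have : rnorm (2%:C *: u) <= 2 * rnorm z.
    have -> : 2%:C *: u = z + z^#.
      by rewrite sz /z addrACA subrr addr0 rmorph_nat scaler_nat mulr2n.
    by apply: le_trans (rnormD _ _) _; rewrite rnorm_star; lra.
  rewrite rnormZR ger0_norm //; lra.
rewrite -zz rnorm_starM; have := rnorm_ge0 u; nra.
Qed.

(** For [0 < c < 1], the contraction [X = c (p + h^2)] of the corner [p A p] has norm
    less than 1, so [p - X] has a square root [z] that commutes with [h].  Then
    [z^2 + c h^2 = (1 - c) p], and the bound on sums of two squares gives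
    [c |h|^2 <= 1 - c]; let [c] tend to 1.  The square root is only needed
    approximately, as [z = p - w_n] for the iterates [w_(n+1) = (X + w_n^2) / 2], which
    are polynomials in [X] with [z^2 = p - X + 2 (w_(n+1) - w_n)]. *)
Lemma corner_sqr_eq0 p h : is_projection p -> h^# = h -> p ** h = h ->
  h ** p = h -> rnorm (p + h ** h) <= 1 -> h = 0.
Proof.
move=> pP sh ph hp T1; have [pp sp] := pP; have p1 := proj_rnorm_le1 pP.
suff small (c : R) : 0 < c < 1 -> c * rnorm h ^+ 2 <= 1 - c.
  apply: rnorm_eq0; have [//|h0] := eqVneq (rnorm h) 0.
  set a := rnorm h ^+ 2 in small.
  have ap2 : 0 < a by rewrite exprn_gt0 // lt_def h0 rnorm_ge0.
  have ap : 0 < 1 + a by lra.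
  (* The midpoint of [1 / (1 + a)] and 1, so that [c * a > 1 - c]. *)
  pose c := (1 + (1 + a)^-1) / 2.
  have ca : c * (1 + a) = 1 + a / 2 by rewrite /c; field; exact: lt0r_neq0.
  have i0 : 0 < (1 + a)^-1 by rewrite invr_gt0.
  have i1 : (1 + a)^-1 < 1 by rewrite invf_lt1 //; lra.
  suff /small : 0 < c < 1 by lra.
  by rewrite /c; apply/andP; split; lra.
move=> /andP[c0 c1].
have [X XE] : exists X : A, X = c%:C *: (p + h ** h) by eexists.
pose w := fix w n : A :=
  if n is m.+1 then (2^-1)%:C *: (X + w m ** w m) else 0.
have pX : p ** X = X by rewrite XE cmulZr cmulDr pp cmulA ph.
have Xp : X ** p = X by rewrite XE cmulZl cmulDl pp -cmulA hp.
have sX : X^# = X by rewrite XE cstarZR cstarD cstarM sp sh.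
have hX : h ** X = X ** h.
  by rewrite XE cmulZr cmulZl cmulDr cmulDl ph hp cmulA.
have Xc : rnorm X <= c.
  by rewrite XE rnormZR gtr0_norm // -[leRHS]mulr1 ler_pM2l.
have wP n : [/\ p ** w n = w n, w n ** p = w n, (w n)^# = w n,
    h ** w n = w n ** h & rnorm (w n) <= c].
  elim: n => [|n [pw wp sw hw wc]] /=.
    by rewrite !cmulx0 !cmul0x cstar0 rnorm0; split=> //; lra.
  split.
  - by rewrite cmulZr cmulDr pX cmulA pw.
  - by rewrite cmulZl cmulDl Xp -cmulA wp.
  - by rewrite cstarZR cstarD cstarM sX sw.
  - by rewrite cmulZr cmulZl cmulDr cmulDl hX cmulA hw -!cmulA hw.
  rewrite rnormZR ger0_norm ?invr_ge0 //.
  have := rnormD X (w n ** w n); have := rnormM (w n) (w n).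
  have := rnorm_ge0 (w n); nra.
have wS n : rnorm (w n.+1 - w n) <= c ^+ n.
  elim: n => [|n IH].
    rewrite subr0 expr0; have [_ _ _ _] := wP 1%N; lra.
  (* Uses [x^2 - y^2 = x (x - y) + (x - y) y], valid without commutativity. *)
  have -> : w n.+2 - w n.+1 = (2^-1)%:C *:
      (w n.+1 ** (w n.+1 - w n) + (w n.+1 - w n) ** w n).
    rewrite [w n.+2]/= -/(w n.+1) [in X in _ - X]/= -/(w n).
    rewrite -scalerBr; congr (_ *: _); rewrite cmulBr cmulBl addrA subrK.
    by rewrite opprD addrACA subrr add0r.
  rewrite rnormZR ger0_norm ?invr_ge0 // exprS.
  have [_ _ _ _ w1] := wP n.+1; have [_ _ _ _ w0] := wP n.
  set d := w n.+1 - w n in IH *.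
  have := rnormD (w n.+1 ** d) (d ** w n).
  have := rnormM (w n.+1) d; have := rnormM d (w n).
  have : rnorm (w n.+1) * rnorm d <= c * c ^+ n.
    by apply: ler_pM => //; exact: rnorm_ge0.
  have : rnorm d * rnorm (w n) <= c ^+ n * c.
    by apply: ler_pM => //; exact: rnorm_ge0.
  lra.
have bound n : c * rnorm h ^+ 2 <= (1 - c) + 2 * c ^+ n.
  have [pw wp sw hw _] := wP n; pose z := p - w n.
  have sz : z^# = z by rewrite cstarB sp sw.
  have hz : h ** z = z ** h by rewrite cmulBr cmulBl hp ph hw.
  pose u : A := (Num.sqrt c)%:C *: h.
  have su : u^# = u by rewrite cstarZR sh.
  have uz : u ** z = z ** u by rewrite cmulZl cmulZr hz.
  have uu : u ** u = c%:C *: (h ** h).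
    by rewrite cmulZl cmulZr scalerA -rmorphM /= -expr2 sqr_sqrtr ?ltW.
  have u2 : rnorm u ^+ 2 = c * rnorm h ^+ 2.
    by rewrite rnormZR exprMn real_normK ?num_real // sqr_sqrtr ?ltW.
  have e : u ** u + z ** z = (1 - c)%:C *: p + 2%:C *: (w n.+1 - w n).
    rewrite uu cmulBl !cmulBr pp pw wp /= scalerBr scalerA -rmorphM /=.
    rewrite mulfV // scale1r rmorphB scalerBl rmorph1 scale1r XE scalerDr.
    rewrite rmorph_nat scaler_nat mulr2n.
    have regroup (x a b y z' : A) :
        a + (x - y - (y - z')) = x - b + (b + a + z' - (y + y)).
      rewrite -(addrA b) -(addrA b) (addrA (x - b)) subrK opprB opprD -!addrA.
      by rewrite (addrCA a x); do 2 congr (_ + _); exact: addrCA.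
    exact: regroup.
  rewrite -u2; apply: le_trans (rnorm_two_squares su sz uz) _.
  rewrite e; apply: le_trans (rnormD _ _) _; rewrite !rnormZR.
  rewrite !ger0_norm; [|lra..]; have := wS n; nra.
have cn : (fun n => (1 - c) + 2 * c ^+ n) @ \oo --> (1 - c) + 2 * 0.
  apply: cvgD; first exact: cvg_cst.
  by apply: cvgM; [exact: cvg_cst|apply: cvg_expr; rewrite gtr0_norm].
rewrite mulr0 addr0 in cn.
by apply: (ler_cvg_to (cvg_cst _) cn); exact: nearW.
Qed.

(** Reduces to squares, since [(p + h)^2 + (p - h)^2 = 2 (p + h^2)]. *)
Lemma corner_vertex p h : is_projection p -> h^# = h -> p ** h = h ->
  h ** p = h -> rnorm (p + h) <= 1 -> rnorm (p - h) <= 1 -> h = 0.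
Proof.
move=> pP sh ph hp hD hB; have [pp sp] := pP.
apply: (corner_sqr_eq0 pP) => //.
have e : 2%:C *: (p + h ** h) = (p + h) ** (p + h) + (p - h) ** (p - h).
  rewrite !(cmulBl, cmulBr, cmulDl, cmulDr) pp ph hp.
  rewrite rmorph_nat scaler_nat mulr2n opprB [in RHS]addrACA.
  rewrite [p + h + _]addrACA subrr addr0.
  by rewrite (addrC (h + _)) (addrA (_ - h)) subrK addrACA.
have : 2 * rnorm (p + h ** h) <= 2.
  rewrite -[X in X * _](@ger0_norm R) // -rnormZR e.
  have := rnormD ((p + h) ** (p + h)) ((p - h) ** (p - h)).
  have := rnormM (p + h) (p + h); have := rnormM (p - h) (p - h).
  have := rnorm_ge0 (p + h); have := rnorm_ge0 (p - h); nra.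
lra.
Qed.

(** The two bounds say that [a] and [-a] are positive; a small multiple [h = t a]
    then satisfies [|p + h| <= 1] and [|p - h| <= 1] by convexity. *)
Lemma corner_pos_antisym p a (M : R) : is_projection p -> a^# = a ->
  p ** a = a -> a ** p = a -> 0 < M ->
  rnorm (p - a) <= 1 -> rnorm (M%:C *: p + a) <= M -> a = 0.
Proof.
move=> pP sa pa ap M0 aB aD; have p1 := proj_rnorm_le1 pP.
(* Chosen so that [1 - t = t * M]: then [p - t a] and [p + t a] are convex
   combinations of [p] with [p - a] and with [p + a / M]. *)
pose t : R := (1 + M)^-1.
have t0 : 0 < t by rewrite invr_gt0; lra.
have tM : t + t * M = 1 by rewrite /t; field; apply: lt0r_neq0; lra.
have Mge : 0 < t * M by exact: mulr_gt0.
suff : t%:C *: a = 0.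
  move/eqP; rewrite scaler_eq0 => /orP[|/eqP//].
  rewrite -(rmorph0 (real_complex R)) => /eqP /complexI t00.
  by move: t0; rewrite t00 ltxx.
apply: (corner_vertex pP); rewrite ?cstarZR ?cmulZr ?cmulZl ?sa ?pa ?ap //.
- have -> : p + t%:C *: a = t%:C *: p + t%:C *: (M%:C *: p + a).
    rewrite scalerDr scalerA addrA -scalerDl -rmorphM -rmorphD /= tM.
    by rewrite rmorph1 scale1r.
  apply: le_trans (rnormD _ _) _; rewrite !rnormZR (gtr0_norm t0).
  have : t * rnorm (M%:C *: p + a) <= t * M by rewrite ler_pM2l.
  nra.
- have -> : p - t%:C *: a = (t * M)%:C *: p + t%:C *: (p - a).
    rewrite scalerBr addrA -scalerDl -rmorphD /= addrC -{1}[p]scale1r.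
    by rewrite [t * M + t]addrC tM rmorph1 addrC.
  apply: le_trans (rnormD _ _) _.
  rewrite !rnormZR (gtr0_norm t0) (gtr0_norm Mge); nra.
Qed.

(** Each summand is [p - c_i] with [|c_i| <= 1], and the [j]-th one is minus the sum
    of the others.  With [M] one more than the number of the others, [M p] plus the
    [j]-th summand is therefore [p] plus the sum of the other [c_i], of norm at most
    [M]. *)
Lemma compress_sum_eq0 (I : eqType) (r : seq I) (q : I -> A) p :
  is_projection p -> (forall i, i \in r -> is_projection (q i)) ->
  \sum_(i <- r) p ** q i ** p = 0 -> forall j, j \in r -> q j ** p = 0.
Proof.
move=> pP qP sum0 j jr; have [pp sp] := pP.
have [qq sq] := qP j jr.
have sum_rest : \sum_(i <- rem j r) p ** q i ** p = - (p ** q j ** p).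
  move: sum0; rewrite (big_rem j jr) /= => sum0.
  by apply/eqP; rewrite -addr_eq0 addrC sum0.
suff c0 : p ** q j ** p = 0.
  apply: rnorm_eq0_starM; rewrite cstarM sp sq -c0 !cmulA.
  by rewrite -[p ** q j ** q j]cmulA qq.
pose M : R := (size (rem j r)).+1%:R.
apply: (@corner_pos_antisym p _ M) => //.
- by rewrite !cstarM sp sq cmulA.
- by rewrite !cmulA pp.
- by rewrite -!cmulA pp.
- exact: proj_compress_rnorm.
have -> : M%:C *: p + p ** q j ** p =
    p + \sum_(i <- rem j r) (p - p ** q i ** p).
  rewrite sumrB sum_rest opprK addrA; congr (_ + _).
  by rewrite big_const_seq count_predT iter_addr_0 -mulrS rmorph_nat scaler_nat.
apply: le_trans (rnormD _ _) _; rewrite /M -[_.+1]add1n natrD.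
apply: lerD; first exact: proj_rnorm_le1.
have : forall i, i \in rem j r -> rnorm (p - p ** q i ** p) <= 1.
  by move=> i /mem_rem ir; apply: proj_compress_rnorm => //; exact: qP.
elim: (rem j r) => [|i s IH] le1; first by rewrite big_nil rnorm0.
rewrite big_cons; apply: le_trans (rnormD _ _) _.
rewrite /= -[_.+1]add1n natrD; apply: lerD; first by rewrite le1 ?mem_head.
by apply: IH => k ks; rewrite le1 // inE ks orbT.
Qed.

End CStarAlgebra.

(** * Linear spans of finite sets are closed *)

Section LinearSpan.
Context {R : realType} {V : normedModType R[i]}.
Implicit Types (S W : set V) (x y : V).

(** The inductive form gives the closure properties of subalgebras by induction on
    the spanning expression. *)
Inductive lin_span S : set V :=
| lin_span0 : lin_span S 0
| lin_span_cons (a : R[i]) x y : S x -> lin_span S y -> lin_span S (a *: x + y).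

Lemma lin_span_sub S : S `<=` lin_span S.
Proof.
by move=> x Sx; rewrite -[x]addr0 -[x]scale1r; apply: lin_span_cons => //;
  exact: lin_span0.
Qed.

Lemma lin_spanD S x y : lin_span S x -> lin_span S y -> lin_span S (x + y).
Proof.
move=> + Sy; elim=> [|a u v Su _ IH]; first by rewrite add0r.
by rewrite -addrA; exact: lin_span_cons.
Qed.

Lemma lin_spanZ S (a : R[i]) x : lin_span S x -> lin_span S (a *: x).
Proof.
elim=> [|c u v Su _ IH]; first by rewrite scaler0; exact: lin_span0.
by rewrite scalerDr scalerA; exact: lin_span_cons.
Qed.

Lemma lin_span_sum S (I : eqType) (r : seq I) (f : I -> V) :
  (forall i, i \in r -> lin_span S (f i)) -> lin_span S (\sum_(i <- r) f i).
Proof.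
move=> Sf; rewrite big_seq; elim/big_rec: _ => [|i x ir]; first exact: lin_span0.
by apply: lin_spanD; exact: Sf.
Qed.

Lemma lin_span_min S W : W 0 -> (forall x y, W x -> W y -> W (x + y)) ->
  (forall (a : R[i]) x, W x -> W (a *: x)) -> S `<=` W -> lin_span S `<=` W.
Proof.
move=> W0 WD WZ SW x; elim=> [//|a u v Su _ IH]; apply: WD => //.
exact/WZ/SW.
Qed.

Lemma lin_span_finite_comb S : finite_set S -> exists (m : nat) (e : 'I_m -> V),
  lin_span S = [set x | exists c : 'I_m -> R[i], x = \sum_(i < m) c i *: e i].
Proof.
move=> /finite_seqP[s Ss]; exists (size s), (fun i => s`_i).
apply/seteqP; split=> x.
- apply: lin_span_min => [|u v|a u|u].
  + by exists (fun=> 0); rewrite big1 // => i _; rewrite scale0r.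
  + move=> [c ->] [d ->]; exists (fun i => c i + d i).
    by rewrite -big_split; apply: eq_bigr => i _; rewrite scalerDl.
  + move=> [c ->]; exists (fun i => a * c i).
    by rewrite scaler_sumr; apply: eq_bigr => i _; rewrite scalerA.
  + rewrite Ss /= => us; have ul : (index u s < size s)%N by rewrite index_mem.
    exists (fun i => (i == Ordinal ul)%:R).
    rewrite (bigD1 (Ordinal ul)) //= eqxx scale1r nth_index // big1 ?addr0 //.
    by move=> i /negPf ->; rewrite scale0r.
- move=> [c ->]; apply: lin_span_sum => i _; apply/lin_spanZ/lin_span_sub.
  by rewrite Ss /= mem_nth.
Qed.

Lemma closure_rnormP S y : closure S y <->
  forall e : R, 0 < e -> exists2 x, S x & rnorm (y - x) < e.
Proof.
split=> [cl e e0|H B /nbhs_ballP[e /= e0 yB]].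
  have /cl[x [Sx]] : nbhs y (ball y e%:C) by apply: nbhsx_ballx; rewrite ltcR.
  by rewrite -ball_normE /= rnormE ltcR => xe; exists x.
have [d0 eE] : 0 < complex.Re e /\ (complex.Re e)%:C = e.
  split; last by rewrite RRe_real // gtr0_real.
  by rewrite -ltcR (RRe_real (gtr0_real e0)).
have [x Sx yx] := H _ d0; exists x; split=> //; apply: yB.
by rewrite -ball_normE /= rnormE -eE ltcR.
Qed.

Lemma closed_rnorm S :
  (forall y, (forall e : R, 0 < e -> exists2 x, S x & rnorm (y - x) < e) ->
    S y) -> closed S.
Proof. by move=> H y /closure_rnormP; exact: H. Qed.

Lemma Re_norm_ge0 (a : R[i]) : 0 <= complex.Re `|a|.
Proof. by rewrite normc_def sqrtr_ge0. Qed.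

Lemma sqrt_sum_sqr_le (a b : R) : Num.sqrt (a ^+ 2 + b ^+ 2) <= `|a| + `|b|.
Proof.
have ab0 : 0 <= `|a| + `|b| by exact: addr_ge0.
rewrite -[leRHS](ger0_norm ab0) -sqrtr_sqr; apply: ler_wsqrtr.
rewrite sqrrD !real_normK ?num_real // addrAC lerDl.
by rewrite mulrn_wge0 // mulr_ge0.
Qed.

(** Completeness of [R[i]], by passing to real and imaginary parts. *)
Lemma complex_cauchy_limit (c : nat -> R[i]) :
  (forall e : R, 0 < e -> exists N, forall n, (N <= n)%N ->
    complex.Re `|c N - c n| < e) ->
  exists l, forall e : R, 0 < e -> exists N, forall n, (N <= n)%N ->
    complex.Re `|c n - l| < e.
Proof.
move=> cC.
have part (f : R[i] -> R) : (forall z w, f (z - w) = f z - f w) ->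
    (forall z, `|f z| <= complex.Re `|z|) ->
    exists l, forall e : R, 0 < e -> exists N, forall n, (N <= n)%N ->
      `|l - f (c n)| < e.
  move=> fB f1; have /cauchy_cvgP cv : cauchy ((f \o c) @ \oo).
    apply: cauchy_exP => e e0; have [N NP] := cC e e0.
    exists (f (c N)); exists N => // n /= Nn.
    by rewrite -ball_normE /= -fB (le_lt_trans (f1 _)) // NP.
  exists (lim ((f \o c) @ \oo)) => e e0.
  move/cvgrPdist_lt: (cv) => /(_ e e0)[N _ NP].
  by exists N => n Nn; exact: NP.
have [z w|z|a aP] := part (@complex.Re R).
- by case: z w => [? ?] [? ?].
- by rewrite normc_def /= -sqrtr_sqr ler_wsqrtr // lerDl sqr_ge0.
have [z w|z|b bP] := part (@complex.Im R).
- by case: z w => [? ?] [? ?].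
- by rewrite normc_def /= -sqrtr_sqr ler_wsqrtr // lerDr sqr_ge0.
exists (a +i* b) => e e0.
have [N1 P1] := aP (e / 2) ltac:(lra); have [N2 P2] := bP (e / 2) ltac:(lra).
exists (maxn N1 N2) => n; rewrite geq_max => /andP[/P1 h1 /P2 h2].
apply: le_lt_trans (_ : `|complex.Re (c n) - a| + `|complex.Im (c n) - b| < e).
  case: (c n) => x y; rewrite normc_def /=.
  exact: sqrt_sum_sqr_le.
by rewrite distrC [X in _ + X]distrC; lra.
Qed.

(** If [x] is at distance [d > 0] from the closed subspace [W], then
    [|a| d <= |a x + v|] for [v] in [W].  So if [a_n x + v_n] converges to [y], the [a_n]
    form a Cauchy sequence, and for their limit [l] the vector [y - l x] is the limit
    of the [v_n]. *)
Lemma closed_add_line W x : W 0 -> (forall x y, W x -> W y -> W (x + y)) ->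
  (forall (a : R[i]) x, W x -> W (a *: x)) -> closed W ->
  closed [set y | exists (a : R[i]) v, W v /\ y = a *: x + v].
Proof.
move=> W0 WD WZ cW; apply: closed_rnorm => y yP.
have [Wx|Wx] := pselect (W x).
  exists 0, y; split; last by rewrite scale0r add0r.
  apply: cW; apply/closure_rnormP => e /yP[_ [a [v [Wv ->]]]] lt_e.
  by exists (a *: x + v) => //; apply: WD => //; exact: WZ.
have [d d0 dP] : exists2 d : R, 0 < d & forall v, W v -> d <= rnorm (x - v).
  apply: contrapT => H; apply: Wx; apply: cW; apply/closure_rnormP => e e0.
  apply: contrapT => H2; apply: H; exists e => // v Wv.
  by rewrite leNgt; apply/negP => lt_e; apply: H2; exists v.
have lower (a : R[i]) v : W v -> complex.Re `|a| * d <= rnorm (a *: x + v).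
  move=> Wv; have [->|a0] := eqVneq a 0.
    by rewrite normr0 mul0r rnorm_ge0.
  have -> : a *: x + v = a *: (x - (- a^-1) *: v).
    by rewrite scaleNr opprK scalerDr scalerA mulfV // scale1r.
  rewrite rnormZ; apply: ler_wpM2l; last by apply: dP; exact: WZ.
  exact: Re_norm_ge0.
have /choice[f fP] : forall n : nat, exists av : R[i] * V,
    W av.2 /\ rnorm (y - (av.1 *: x + av.2)) < n.+1%:R^-1.
  move=> n; have [_ [a [v [Wv ->]]] lt_n] := yP n.+1%:R^-1 ltac:(by []).
  by exists (a, v).
have [|l lP] := @complex_cauchy_limit (fun n => (f n).1).
  move=> e e0; have ed : 0 < e * d / 2 by rewrite divr_gt0 ?mulr_gt0.
  have [N NP] : exists N : nat, N.+1%:R^-1 < e * d / 2.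
    have [N _ NP] := near_infty_natSinv_lt (PosNum ed).
    by exists N; apply: NP => /=.
  exists N => n Nn; rewrite -(ltr_pM2r d0).
  have [[WN fN] [Wn fn]] := (fP N, fP n).
  have := lower ((f N).1 - (f n).1) ((f N).2 - (f n).2) _.
  move=> /(_ _)/le_lt_trans; apply.
    by apply: WD => //; rewrite -scaleN1r; exact: WZ.
  rewrite scalerBl addrACA -opprD.
  apply: le_lt_trans (rnormBD y _ _) _; rewrite (rnormBC _ y).
  have : n.+1%:R^-1 <= N.+1%:R^-1 :> R by rewrite lef_pV2 ?posrE // ler_nat.
  move: (n.+1%:R^-1) (N.+1%:R^-1) fN fn NP => r t; lra.
exists l, (y - l *: x); split; last by rewrite addrC subrK.
apply: cW; apply/closure_rnormP => e e0.
have e20 : 0 < e / 2 by rewrite divr_gt0.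
have x0 := rnorm_ge0 x.
have [|N1 P1] := lP (e / 2 / (rnorm x + 1)); first by rewrite divr_gt0 //; lra.
have [N2 _ P2] := near_infty_natSinv_lt (PosNum e20).
pose n := maxn N1 N2; exists (f n).2; first by have [] := fP n.
have {P1} := P1 n (leq_maxl _ _); have {P2} /= := P2 n (leq_maxr _ _).
have [_] := fP n; set u := f n => fn n2 lu.
have {n2}fn : rnorm (y - (u.1 *: x + u.2)) < e / 2 := lt_trans fn n2.
have -> : y - l *: x - u.2 = (y - (u.1 *: x + u.2)) + (u.1 - l) *: x.
  by rewrite scalerBl opprD -!addrA; congr (_ + _); rewrite [RHS]addrCA addKr addrC.
apply: le_lt_trans (rnormD _ _) _; rewrite rnormZ.
have : complex.Re `|u.1 - l| * rnorm x <= e / 2.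
  move: lu; rewrite ltr_pdivlMr; last lra.
  have := Re_norm_ge0 (u.1 - l).
  by rewrite mulrDr mulr1 /=; lra.
lra.
Qed.

Lemma closed_lin_span S : finite_set S -> closed (lin_span S).
Proof.
move=> /finite_seqP[s ->]; elim: s => [|x s IH].
  apply: closed_rnorm => y yP; suff -> : y = 0 by exact: lin_span0.
  apply: rnorm_eq0; apply/eqP; rewrite eq_le rnorm_ge0 andbT.
  apply/ler_addgt0Pr => e e0; rewrite add0r; have [z zP lt_e] := yP e e0.
  suff z0 : z = 0 by rewrite z0 subr0 in lt_e; exact: ltW.
  by case: zP.
suff -> : lin_span [set` x :: s] =
    [set y | exists (a : R[i]) v, lin_span [set` s] v /\ y = a *: x + v].
  apply: closed_add_line => //; first exact: lin_span0.
    exact: lin_spanD.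
  exact: lin_spanZ.
apply/seteqP; split=> y.
  elim=> [|a u v /= + _ [c [w [sw ->]]]].
    by exists 0, 0; rewrite scale0r addr0; split=> //; exact: lin_span0.
  rewrite inE => /predU1P[->|us].
    by exists (a + c), w; rewrite scalerDl addrA.
  exists c, (a *: u + w); split; last by rewrite addrCA.
  exact: lin_span_cons.
move=> [a [v [sv ->]]]; apply: lin_span_cons; first by rewrite /= mem_head.
apply: lin_span_min sv; first exact: lin_span0.
- exact: lin_spanD.
- exact: lin_spanZ.
- by move=> u us; apply: lin_span_sub; rewrite /= inE us orbT.
Qed.

End LinearSpan.

(** * Star-subalgebras and their closures *)

Section StarSubalgebra.
Context {R : realType} {A : cstarAlgType R}.
Implicit Types (S : set A) (x y : A).

(** A C*-subalgebra without the topological requirement, so that an increasing union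
    qualifies. *)
Definition is_star_subalgebra S : Prop :=
  [/\ [/\ S 0,
          forall x y, S x -> S y -> S (x + y) &
          forall (a : R[i]) x, S x -> S (a *: x)],
      forall x y, S x -> S y -> S (x ** y) &
      forall x, S x -> S x^#].

Lemma lin_span_star_subalgebra S :
  (forall x y, S x -> S y -> lin_span S (x ** y)) ->
  (forall x, S x -> S x^#) -> is_star_subalgebra (lin_span S).
Proof.
move=> SM Sstar; split; [split|move=> x y Sx Sy|move=> x].
- exact: lin_span0.
- exact: lin_spanD.
- exact: lin_spanZ.
- elim: Sx => [|a u v Su _ IHx]; first by rewrite cmul0x; exact: lin_span0.
  rewrite cmulDl cmulZl; apply: lin_spanD IHx; apply: lin_spanZ.
  elim: Sy => [|c w z Sw _ IHy]; first by rewrite cmulx0; exact: lin_span0.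
  by rewrite cmulDr cmulZr; apply: lin_spanD IHy; apply: lin_spanZ; exact: SM.
- elim=> [|a u v Su _ IH]; first by rewrite cstar0; exact: lin_span0.
  by rewrite cstarD cstarZ; apply: lin_span_cons IH; exact: Sstar.
Qed.

Lemma bigcup_star_subalgebra (F : nat -> set A) :
  (forall n, is_star_subalgebra (F n)) -> (forall n, F n `<=` F n.+1) ->
  is_star_subalgebra (\bigcup_n F n).
Proof.
move=> FA FS; have Fmono n m : (n <= m)%N -> F n `<=` F m.
  move/subnK <-; elim: (m - n)%N => [//|d IH]; exact: subset_trans (FS _).
split; [split|..].
- by exists 0%N => //; have [[]] := FA 0%N.
- move=> x y [n _ Fx] [m _ Fy]; exists (maxn n m) => //.
  have [[_ D _] _ _] := FA (maxn n m).
  by apply: D; [apply: Fmono Fx; exact: leq_maxl|apply: Fmono Fy; exact: leq_maxr].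
- by move=> a x [n _ Fx]; exists n => //; have [[_ _ Z] _ _] := FA n; exact: Z.
- move=> x y [n _ Fx] [m _ Fy]; exists (maxn n m) => //.
  have [_ M _] := FA (maxn n m).
  by apply: M; [apply: Fmono Fx; exact: leq_maxl|apply: Fmono Fy; exact: leq_maxr].
- by move=> x [n _ Fx]; exists n => //; have [_ _ st] := FA n; exact: st.
Qed.

Lemma closure_star_subalgebra S :
  is_star_subalgebra S -> is_cstar_subalgebra (closure S).
Proof.
move=> [[S0 SD SZ] SM Sst]; split; [split|..].
- exact: subset_closure.
- move=> x y /closure_rnormP Sx /closure_rnormP Sy; apply/closure_rnormP => e e0.
  have e20 : 0 < e / 2 by rewrite divr_gt0.
  have [x' x'S xx'] := Sx _ e20; have [y' y'S yy'] := Sy _ e20.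
  exists (x' + y'); first exact: SD.
  by rewrite opprD addrACA; apply: le_lt_trans (rnormD _ _) _; lra.
- move=> a x /closure_rnormP Sx; apply/closure_rnormP => e e0.
  have a0 := Re_norm_ge0 a.
  have [|x' x'S xx'] := Sx (e / (complex.Re `|a| + 1)).
    by rewrite divr_gt0 //; lra.
  exists (a *: x'); first exact: SZ.
  rewrite -scalerBr rnormZ; move: xx'; rewrite ltr_pdivlMr; last lra.
  have := rnorm_ge0 (x - x'); nra.
- move=> x y /closure_rnormP Sx /closure_rnormP Sy; apply/closure_rnormP => e e0.
  (* The tolerance for [x'] depends on the approximant [y'] already chosen. *)
  have [|y' y'S yy'] := Sy (e / 2 / (rnorm x + 1)).
    by rewrite !divr_gt0 //; have := rnorm_ge0 x; lra.
  have [|x' x'S xx'] := Sx (e / 2 / (rnorm y' + 1)).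
    by rewrite !divr_gt0 //; have := rnorm_ge0 y'; lra.
  exists (x' ** y'); first exact: SM.
  have -> : x ** y - x' ** y' = x ** (y - y') + (x - x') ** y'.
    by rewrite cmulBr cmulBl addrA subrK.
  have x0 := rnorm_ge0 x; have y0 := rnorm_ge0 y'.
  have dx := rnorm_ge0 (x - x'); have dy := rnorm_ge0 (y - y').
  move: yy' xx'; rewrite !ltr_pdivlMr; [|lra..] => yy' xx'.
  apply: le_lt_trans (rnormD _ _) _.
  have := rnormM x (y - y'); have := rnormM (x - x') y'; lra.
- move=> x /closure_rnormP Sx; apply/closure_rnormP => e e0.
  have [x' x'S xx'] := Sx e e0; exists x'^#; first exact: Sst.
  by rewrite -cstarB rnorm_star.
- exact: closed_closure.
Qed.

End StarSubalgebra.

(** * Orthogonality and matrix units in a k-graph family *)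

Section KGraphFamily.
Context {R : realType} {k : nat} {L : kgraph k} {A : cstarAlgType R} {s : L -> A}.
Hypotheses (hL : row_finite_no_sources L) (hs : is_kgraph_family s).
Implicit Types l m nu : L.

Let s_comp l m : ksrc l = krng m -> s (kcompose l m) = s l ** s m.
Proof. by case: hs => _ _ H _ _; exact: H. Qed.

Lemma family_idl l : s (kid (krng l)) ** s l = s l.
Proof. by rewrite -s_comp ?ksrc_id // kcomp_idl. Qed.

Lemma family_idr l : s l ** s (kid (ksrc l)) = s l.
Proof. by rewrite -s_comp ?krng_id // kcomp_idr. Qed.

Lemma family_range_projection l : is_projection (s l ** (s l)^#).
Proof.
have [/(_ l) pis _ _ _ _] := hs.
by split; rewrite ?cstarM ?cstarK // cmulA pis.
Qed.

Lemma family_vertex_sum v n : exists r : seq L,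
  [/\ uniq r, forall l, l \in r <-> paths_at n v l &
      s (kid v) = \sum_(l <- r) s l ** (s l)^#].
Proof.
have [_ _ _ _ sum_v] := hs; have [_ fin] := hL v n.
exists (finmap.enum_fset (fset_set (paths_at n v))).
split; first exact: finmap.fset_uniq.
  by move=> l; rewrite in_fset_set // inE.
by rewrite (sum_v v n) fsbig_finite.
Qed.

Lemma family_orth_of_range l m : krng l <> krng m -> (s l)^# ** s m = 0.
Proof.
move=> rlm; have [_ [vP vO] _ _ _] := hs; have [_ sp] := vP (krng l).
rewrite -(family_idl l) cstarM sp -(family_idl m) cmulA.
by rewrite -(cmulA (s l)^#) vO // cmulx0 cmul0x.
Qed.

(** The range projections [q_nu] of the paths of this degree sum to the vertex
    projection, which acts as the identity on [q_m].  Compressing the sum by [q_m]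
    leaves [q_m] on both sides, so the compressions of the other [q_nu] sum to 0. *)
Lemma family_orth_of_degree l m :
  krng l = krng m -> kdeg l = kdeg m -> l <> m -> (s l)^# ** s m = 0.
Proof.
move=> rlm dlm lm; have [pis _ _ _ _] := hs.
pose q nu := s nu ** (s nu)^#.
have qP nu : is_projection (q nu) := family_range_projection nu.
have [r [ur rP sumr]] := family_vertex_sum (krng m) (kdeg m).
have mr : m \in r by apply/rP.
have lr : l \in rem m r by rewrite mem_rem_uniq // inE (introN eqP lm); apply/rP.
have ql0 : q l ** q m = 0.
  apply: (compress_sum_eq0 (qP m)) lr => [i _|]; first exact: qP.
  have : \sum_(i <- r) q m ** q i ** q m = q m ** q m ** q m.
    rewrite -cmul_suml -cmul_sumr -sumr -(cmulA (q m) (s _)).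
    have [qq _] := qP m; rewrite qq.
    by rewrite [X in _ ** X](_ : _ = q m) // /q cmulA family_idl.
  by rewrite (big_rem m mr) /= -[RHS]addr0 => /addrI.
have sl : (s l)^# = (s l)^# ** q l by rewrite -{1}(pis l) !cstarM cstarK.
have sm : s m = q m ** s m by rewrite pis.
by rewrite sl sm cmulA -(cmulA (s l)^#) ql0 cmulx0 cmul0x.
Qed.

Lemma family_unit_expand l m n : ksrc l = ksrc m -> exists r : seq L,
  (forall nu, nu \in r -> paths_at n (ksrc l) nu) /\
  s l ** (s m)^# =
    \sum_(nu <- r) s (kcompose l nu) ** (s (kcompose m nu))^#.
Proof.
move=> lm; have [r [_ rP sumr]] := family_vertex_sum (ksrc l) n.
exists r; split; first by move=> nu /rP.
rewrite -{1}(family_idr l) sumr cmul_sumr cmul_suml !big_seq.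
apply: eq_bigr => nu /rP[_ rnu].
by rewrite !s_comp -?lm // cstarM !cmulA.
Qed.

End KGraphFamily.

(** * Finite-dimensional subalgebras along the diagonal levels *)

Section Levels.
Context {R : realType} {k : nat} {L : kgraph k} {A : cstarAlgType R} {s : L -> A}.
Hypotheses (hL : row_finite_no_sources L) (hs : is_kgraph_family s).
Variable b : kobj L -> 'rV[int]_k.
Hypothesis hb : forall l : L, map_mx Posz (kdeg l) = b (ksrc l) - b (krng l).
Implicit Types l m nu : L.

(** The degree is determined by the levels of the end points, so that for fixed
    range and level of the source only one degree occurs. *)
Lemma kdeg_level l : kdeg l = map_mx absz (b (ksrc l) - b (krng l)).
Proof. by rewrite -hb; apply/matrixP => i j; rewrite !mxE. Qed.

Lemma level_orth l m : b (ksrc l) = b (ksrc m) -> l <> m -> (s l)^# ** s m = 0.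
Proof.
move=> blm lm; have [rlm|rlm] := pselect (krng l = krng m).
  by apply: family_orth_of_degree => //; rewrite !kdeg_level blm rlm.
exact: family_orth_of_range.
Qed.

(** Defined by what the paths extend, so that stability under extension from level
    [N] to level [N+1] is associativity of composition; [pickle] provides the
    enumeration of the paths. *)
Definition frontier N : set L :=
  [set l | b (ksrc l) = const_mx (Posz N) /\
     exists m nu, [/\ (pickle m < N)%N, ksrc m = krng nu & l = kcompose m nu]].

Lemma frontier_finite N : finite_set (frontier N).
Proof.
pose early := [set m : L | (pickle m < N)%N].
pose tails m := paths_at (map_mx absz (const_mx (Posz N) - b (ksrc m))) (ksrc m).
apply: (@sub_finite_set _ _ (\bigcup_(m in early) (kcompose m @` tails m))).
  move=> l [bl [m [nu [mN mnu lE]]]]; exists m => //; exists nu => //.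
  by split; rewrite // kdeg_level -mnu -bl lE ksrc_comp.
apply: bigcup_finite => [|m _]; last first.
  by apply: finite_image; have [_] := hL (ksrc m)
    (map_mx absz (const_mx (Posz N) - b (ksrc m))).
have -> : early = pickle @^-1` `I_N by [].
apply: finite_preimage; last exact: finite_II.
by move=> m m' _ _; exact: (pcan_inj pickleK).
Qed.

Definition frontier_units N : set A :=
  [set x | exists l m, [/\ frontier N l, frontier N m, ksrc l = ksrc m &
                           x = s l ** (s m)^#]].

Lemma frontier_units_finite N : finite_set (frontier_units N).
Proof.
have fin := frontier_finite N.
apply: (sub_finite_set (B := (fun p : L * L => s p.1 ** (s p.2)^#) @`
  (frontier N `*` frontier N))).
  by move=> x [l [m [lN mN _ ->]]]; exists (l, m).
by apply: finite_image; exact: finite_setX.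
Qed.

Lemma frontier_star_subalgebra N :
  is_star_subalgebra (lin_span (frontier_units N)).
Proof.
apply: lin_span_star_subalgebra => [x y|x]; last first.
  by move=> [l [m [lN mN lm ->]]]; exists m, l; rewrite cstarM cstarK.
move=> [l [m [lN mN lm ->]]] [l' [m' [lN' mN' lm' ->]]].
have [ml'|ml'] := pselect (m = l'); last first.
  rewrite cmulA -(cmulA (s l)) level_orth //; last first.
    by case: mN lN' => [-> _] [-> _].
  by rewrite cmulx0 cmul0x; exact: lin_span0.
have [_ _ _ iso _] := hs; subst l'.
rewrite cmulA -(cmulA (s l)) iso -lm family_idr //.
by apply: lin_span_sub; exists l, m'; rewrite lm.
Qed.

(** How a unit enters stage [N]: it is expanded along the paths [nu] that lead from
    its source to level [(N, ..., N)]. *)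
Lemma unit_frontier N l m : ksrc l = ksrc m ->
  (exists n : 'rV[nat]_k, map_mx Posz n = const_mx (Posz N) - b (ksrc l)) ->
  (forall nu, ksrc l = krng nu -> b (ksrc nu) = const_mx (Posz N) ->
    frontier N (kcompose l nu) /\ frontier N (kcompose m nu)) ->
  lin_span (frontier_units N) (s l ** (s m)^#).
Proof.
move=> lm [n nE] fr; have [r [rP ->]] := family_unit_expand hL hs n lm.
apply: lin_span_sum => nu /rP[dnu rnu]; apply: lin_span_sub.
have [] := fr nu _ _; first by rewrite rnu.
  by have := hb nu; rewrite dnu rnu nE => /addIr.
exists (kcompose l nu), (kcompose m nu); split=> //.
by rewrite !ksrc_comp // -?lm.
Qed.

(** The expansion is along paths of degree [(1, ..., 1)], the gap between the two
    levels. *)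
Lemma frontier_increasing N :
  lin_span (frontier_units N) `<=` lin_span (frontier_units N.+1).
Proof.
apply: lin_span_min.
- exact: lin_span0.
- exact: lin_spanD.
- exact: lin_spanZ.
have ext l nu : frontier N l -> ksrc l = krng nu ->
    b (ksrc nu) = const_mx (Posz N.+1) -> frontier N.+1 (kcompose l nu).
  move=> [_ [m [mu [mN mmu ->]]]]; rewrite ksrc_comp // => munu bnu.
  split; first by rewrite !ksrc_comp.
  exists m, (kcompose mu nu); split; rewrite ?krng_comp ?kcompA //.
  exact: ltnW.
move=> _ [l [m [lN mN lm ->]]]; apply: unit_frontier => //.
  exists (const_mx 1%N); have [-> _] := lN; apply/matrixP => i j.
  by rewrite !mxE; lia.
by move=> nu lnu bnu; split; apply: ext; rewrite -?lm.
Qed.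

(** [s_l] is the unit [s_l s_v^*] with [v] the source of [l]; the stage has to come
    after [l] and [v] in the enumeration and lie above the level of [v]. *)
Lemma frontier_generator l :
  exists N, lin_span (frontier_units N) (s l).
Proof.
pose v := ksrc l.
pose N := (\max_(i < k) absz (b v ord0 i) + pickle l + pickle (kid v)).+1.
exists N.
have [_ [/(_ v)[_ sp] _] _ _ _] := hs.
rewrite -(family_idr hs l) -sp; apply: unit_frontier; first by rewrite ksrc_id.
  exists (map_mx absz (const_mx (Posz N) - b v)).
  apply/matrixP => i j; rewrite !mxE ord1 gez0_abs // subr_ge0.
  apply: le_trans (ler_norm _) _; rewrite -abszE lez_nat.
  apply: leq_trans (_ : _ <= \max_(i < k) absz (b v ord0 i))%N _.
    exact: (@leq_bigmax _ (fun i : 'I_k => absz (b v ord0 i))).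
  by rewrite /N; lia.
move=> nu lnu bnu; have vnu : ksrc (kid v) = krng nu by rewrite ksrc_id.
split; split; rewrite ?ksrc_comp //; [exists l, nu|exists (kid v), nu].
  by split=> //; rewrite /N; lia.
by split=> //; rewrite /N; lia.
Qed.

End Levels.

Theorem lemma5p4 (R : realType) (k : nat) (hk : (0 < k)%N) (L : kgraph k)
    (hL : row_finite_no_sources L)
    (b : kobj L -> 'rV[int]_k)
    (hb : forall l : L, map_mx Posz (kdeg l) = b (ksrc l) - b (krng l))
    (A : cstarAlgType R) (s : L -> A) (hA : is_kgraph_cstar s) :
  is_AF A.
Proof.
have [hs gen _] := hA.
pose F N := lin_span (frontier_units (s := s) b N).
have FA N : is_star_subalgebra (F N) by exact: frontier_star_subalgebra.
have FS N : F N `<=` F N.+1 by exact: frontier_increasing.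
have Ffin N : finite_set (frontier_units (s := s) b N).
  exact: frontier_units_finite.
exists F; split=> // [N|N|].
- by have [? ? ?] := FA N; split=> //; exact: closed_lin_span.
- exact: lin_span_finite_comb.
apply: gen => [|l].
  by apply: closure_star_subalgebra; exact: bigcup_star_subalgebra.
apply: subset_closure; have [N FN] := frontier_generator hL hs hb l.
by exists N.
Qed.
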